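(* Let $r\ge 1$ be an integer. (i) For every finite tree $T$ with edge set $F$ and every finite multiset $\mathcal{P}$ of paths in $T$ each having at least $r$ edges, there is a colouring of $F$ with $\lceil r/2\rceil$ colours such that every path in $\mathcal{P}$ contains an edge of each colour. (ii) There exist a finite tree $T$ and a finite family $\mathcal{P}$ of paths in $T$, each with at least $r$ edges, such that for no colouring of the edges of $T$ with $\lceil r/2\rceil+1$ colours does every path in $\mathcal{P}$ contain an edge of each colour. In other words, over all hypergraphs whose vertex set is the edge set of a tree and whose hyperedges are edge sets of paths, with all hyperedges of size at least $r$, the minimum polychromatic number is exactly $\lceil r/2\rceil$.
   Context: A polychromatic $k$-colouring of a hypergraph is a map from its vertices to $k$ colours such that every hyperedge contains a vertex of every colour; the polychromatic number is the maximum $k$ for which one exists. *)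

(* Defs.v *)
From HB Require Import structures.
From mathcomp Require Import all_boot.

Set Implicit Arguments.
Unset Strict Implicit.
Unset Printing Implicit Defensive.

Section Hypergraph.

(* A hypergraph on the vertex set X is given by the list of its hyperedges,
   read as a finite multiset. *)
Variables (X : finType) (E : seq {set X}).

Definition polychromatic (k : nat) (c : X -> 'I_k) : Prop :=
  forall A, A \in E -> forall i : 'I_k, exists2 x, x \in A & c x = i.

(* A relation rather than a function: if E is empty and X is not, every k > 0
   admits a polychromatic k-colouring and the maximum does not exist. *)
Definition is_polychromatic_number (m : nat) : Prop :=
  (exists c : X -> 'I_m, polychromatic c) /\
  (forall (k : nat) (c : X -> 'I_k), polychromatic c -> k <= m).

End Hypergraph.

Section Tree.

Variables (V : finType) (e : rel V).

(* The bound 2 in the last clause: [:: x; y] is a ucycle for every edge xy, and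
   the cycles of a simple graph are its ucycles of size at least 3. *)
Definition is_tree : Prop :=
  [/\ symmetric e, irreflexive e, 0 < #|V|,
      forall x y, connect e x y
    & forall c : seq V, ucycle e c -> size c <= 2].

Definition edge_set : {set {set V}} :=
  [set [set x; y] | x in V, y in V & e x y].

Definition edge : finType := {f : {set V} | f \in edge_set}.

(* A path is given by the sequence of its (pairwise distinct) vertices. *)
Definition is_path (s : seq V) : bool :=
  [&& s != [::], sorted e s & uniq s].

Definition path_edges (s : seq V) : {set edge} :=
  [set f : edge | val f \in [seq [set u.1; u.2] | u <- zip s (behead s)]].

Definition path_family (r : nat) (P : seq (seq V)) : Prop :=
  forall s, s \in P -> is_path s /\ r <= #|path_edges s|.

Definition path_hypergraph (P : seq (seq V)) : seq {set edge} :=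
  [seq path_edges s | s <- P].

End Tree.

(* Main.v *)
Require Import Defs.
From HB Require Import structures.
From mathcomp Require Import all_boot.
From mathcomp Require Import zify.

Set Implicit Arguments.
Unset Strict Implicit.
Unset Printing Implicit Defensive.

(** Root the tree and colour each edge by the depth of its lower end modulo
    [uphalf r].  The depth along a path has no interior local maximum, so a path
    with at least [r] edges contains a vertical stretch of [uphalf r] edges,
    whose labels are consecutive integers.

    For the other direction, let [k = uphalf r] and take a spider with [k + 2]
    legs of [k] edges each.  Under [k + 1] colours every leg misses a colour, so
    two legs miss the same one, and the path of [2k] edges joining their tips is
    not polychromatic. *)

Section Polychromatic.

Variables (X : finType) (E : seq {set X}).

(** Collapsing all colours from [m] upwards into [m] loses none of the first [m.+1], so excluding
    one number of colours excludes every larger one. *)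
Lemma polychromatic_merge (k m : nat) (c : X -> 'I_k) :
  m < k -> polychromatic E c ->
  polychromatic E (fun x => inord (minn (c x) m) : 'I_m.+1).
Proof.
move=> mk Hc A AE i.
have [x xA cx] := Hc A AE (widen_ord mk i).
have im := ltn_ord i.
by exists x => //; apply: val_inj; rewrite cx /= inordK; lia.
Qed.

End Polychromatic.

(** * Edge sets of paths *)

Section PathEdges.

Variables (V : finType) (e : rel V).

Lemma edge_setP (f : {set V}) :
  reflect (exists x y, e x y /\ f = [set x; y]) (f \in edge_set e).
Proof.
apply: (iffP imset2P) => [[x y _]|[x [y [exy ->]]]].
  by rewrite inE => /andP[_ exy] ->; exists x, y.
by exists x y; rewrite ?inE.
Qed.

Lemma sorted_zip_behead (s : seq V) u :
  sorted e s -> u \in zip s (behead s) -> [/\ e u.1 u.2, u.1 \in s & u.2 \in s].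
Proof.
case: s => // x s /=; elim: s x => // y s IH x /= /andP[exy ys].
rewrite inE => /predU1P[->|/(IH y ys)[? u1 u2]] /=.
  by rewrite !inE !eqxx !orbT.
by split=> //; rewrite inE ?u1 ?u2 orbT.
Qed.

(** Consecutive pairs are distinct because the first vertex of a pair never recurs later in the
    path. *)
Lemma path_edges_card (s : seq V) :
  is_path e s -> #|path_edges e s| = (size s).-1.
Proof.
case/and3P=> s0 se su.
set Z := [seq [set u.1; u.2] | u <- zip s (behead s)].
have Zu : uniq Z.
  rewrite {}/Z; case: s s0 se su => // x s _ /=.
  elim: s x => // y s IH x /= /andP[exy ys] /andP[xs ysu].
  rewrite IH // andbT; apply/mapP=> -[u /(@sorted_zip_behead (y :: s))] /=.
  case=> // _ u1 u2 /setP/(_ x); rewrite !inE eqxx /=.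
  by case/esym/orP=> /eqP xu; move: xs; rewrite xu ?u1 ?u2.
have -> : (size s).-1 = size Z.
  by rewrite size_map size_zip size_behead; lia.
rewrite -(card_uniqP Zu) -(card_imset _ val_inj).
apply: eq_card => f; apply/imsetP/idP => [[g gs ->]|fZ].
  by move: gs; rewrite inE.
have fe : f \in edge_set e.
  case/mapP: fZ => u /sorted_zip_behead[] // e12 _ _ ->.
  by apply/edge_setP; exists u.1, u.2.
by exists (exist _ f fe); rewrite ?inE.
Qed.

Lemma path_edges_nth (x0 : V) (s : seq V) i :
  sorted e s -> i.+1 < size s ->
  exists2 f : edge e, f \in path_edges e s
    & val f = [set nth x0 s i; nth x0 s i.+1].
Proof.
move=> se is_.
have eis : e (nth x0 s i) (nth x0 s i.+1) by apply: (sortedP x0 se).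
have fe : [set nth x0 s i; nth x0 s i.+1] \in edge_set e.
  by apply/edge_setP; exists (nth x0 s i), (nth x0 s i.+1).
exists (exist _ [set nth x0 s i; nth x0 s i.+1] fe) => //; rewrite inE /=; apply/mapP.
have iz : i < size (zip s (behead s)) by rewrite size_zip size_behead; lia.
exists (nth (x0, x0) (zip s (behead s)) i); first exact: mem_nth.
by rewrite nth_zip_cond iz nth_behead.
Qed.

End PathEdges.

(** * Depth in trees and the colouring modulo [k] *)

Section Depth.

Variables (V : finType) (e : rel V).

(* Where two simple paths with the same ends diverge, the rest of the first followed
   by the reverse of the rest of the second avoids [x] and closes up to a cycle. *)
Lemma uniq_path_unique :
  symmetric e -> (forall c : seq V, ucycle e c -> size c <= 2) ->
  forall x p q, path e x p -> path e x q -> uniq (x :: p) -> uniq (x :: q) ->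
    last x p = last x q -> p = q.
Proof.
move=> esym acyc x p; elim: p x => [|a p IH] x [|b q] //=.
- by move=> _ _ _ /andP[xq _] xl; rewrite {1}xl mem_last in xq.
- by move=> _ _ /andP[xp _] _ xl; rewrite -{1}xl mem_last in xp.
move=> /andP[exa pa] /andP[exb qb] /andP[xp up] /andP[xq uq] lpq.
have [ab|ab] := eqVneq a b; first by subst b; rewrite (IH a q).
(* Adjacency with [x] deleted; both remainders survive in it, so their common end connects [a] to
   [b]. *)
pose e' := [rel u v | [&& e u v, u != x & v != x]].
have e'sym : connect_sym e'.
  by apply: sym_connect_sym => u v /=; rewrite esym [(u != x) && _]andbC.
have e'conn z s : path e z s -> x \notin z :: s -> connect e' z (last z s).
  move=> zs xs; apply/connectP; exists s => //.
  elim: s z zs xs => //= y s IHs z /andP[ezy ys].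
  rewrite !inE !negb_or => /and3P[xz xy xs].
  by rewrite ezy !(eq_sym _ x) xz xy IHs // inE negb_or xy.
have : connect e' a b.
  by apply: connect_trans (e'conn a p pa xp) _; rewrite lpq e'sym e'conn.
case/connectP=> s0 ps0 bE; case/shortenP: ps0 bE => s ps us _ bE.
have [se sx] : path e a s /\ x \notin s.
  elim: (s) (a) ps => //= y t IHt z /andP[/and3P[ezy _ yx] /IHt[-> xt]].
  by rewrite ezy inE negb_or eq_sym yx.
have : ucycle e [:: x, a & s].
  rewrite /ucycle /= rcons_path exa se -bE esym exb /=.
  move: xp; rewrite !inE !negb_or => /andP[-> _].
  by rewrite sx.
(* The bound 2 leaves [s] empty, which forces [b = a]. *)
move/acyc => /=; case: s {ps us se sx} bE => //= bE.
by rewrite bE eqxx in ab.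
Qed.

(** Captures distance from a root without naming the root. It serves both to colour trees and to
    show that the spider is acyclic. *)
Definition depth_function (d : V -> nat) : Prop :=
  (forall x y, e x y -> d y = (d x).+1 \/ d x = (d y).+1) /\
  (forall x y z, e x y -> e x z -> d y < d x -> d z < d x -> y = z).

(** Depth is the length of the unique simple path from an arbitrary root. Along an edge one root
    path extends the other by one vertex, so a neighbour of smaller depth is the penultimate vertex
    of the root path. *)
Lemma tree_depth : is_tree e -> exists d, depth_function d.
Proof.
case=> esym eirr V0 conn acyc.
have /card_gt0P[x0 _] := V0.
have pE x : exists p, [&& path e x0 p, uniq (x0 :: p) & last x0 p == x].
  have /connectP[p0 pp ->] := conn x0 x.
  by case/shortenP: pp => p pp pu _; exists p; rewrite pp pu eqxx.
pose p x := xchoose (pE x).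
have pP x : [/\ path e x0 (p x), uniq (x0 :: p x) & last x0 (p x) = x].
  by have /and3P[? ? /eqP] := xchooseP (pE x).
have pU x q : path e x0 q -> uniq (x0 :: q) -> last x0 q = x -> q = p x.
  move=> q1 q2 q3; have [p1 p2 p3] := pP x.
  by apply: (uniq_path_unique esym acyc q1 p1 q2 p2); rewrite q3.
have pR x y : e x y -> y \notin x0 :: p x -> p y = rcons (p x) y.
  move=> exy yp; have [p1 p2 p3] := pP x.
  symmetry; apply: pU; rewrite ?last_rcons //; first by rewrite rcons_path p1 p3.
  by rewrite -rcons_cons rcons_uniq yp.
have pV x y : e x y -> p y = rcons (p x) y \/ p x = rcons (p y) x.
  move=> exy; have [|] := boolP (y \in x0 :: p x); last by left; apply: pR.
  move=> yp; right; apply: pR; first by rewrite esym.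
  have xy : x != y by apply: contraTneq exy => ->; rewrite eirr.
  (* Cut the root path of [x] at [y]: the first piece is the root path of [y], and [x], the end of
     the nonempty second piece, lies off it. *)
  move: (p x) yp (pP x) => q yq; case/splitPl: yq => q1 q2 ly [].
  rewrite cat_path => /andP[q1p _] q12u q12l.
  have q1y : q1 = p y.
    by apply: pU => //; move: q12u; rewrite -cat_cons cat_uniq => /andP[].
  rewrite -q1y; move: q12u q12l; rewrite -cat_cons cat_uniq last_cat ly.
  case/and3P=> _ /hasPn q12 _; case: q2 q12 => [_ /= yx|z q2 q12 /= xE].
    by rewrite yx eqxx in xy.
  by apply: q12; rewrite -xE mem_last.
exists (fun x => size (p x)); split=> [x y /pV[]->|x y z exy exz].
- by left; rewrite size_rcons.
- by right; rewrite size_rcons.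
case: (pV x y exy) => [->|pxy]; first by rewrite size_rcons; lia.
case: (pV x z exz) => [->|pxz]; first by rewrite size_rcons; lia.
move=> _ _; have [_ _ <-] := pP y; have [_ _ <-] := pP z.
by move: pxz; rewrite pxy => /rcons_inj[->].
Qed.

(** On a cycle of length at least 3, a vertex of maximal depth would have two distinct neighbours of
    smaller depth. *)
Lemma depth_acyclic d (c : seq V) :
  depth_function d -> ucycle e c -> symmetric e -> size c <= 2.
Proof.
move=> [d1 d2] ce esym; rewrite leqNgt; apply/negP => c3.
have [x0 x0c] : exists x, x \in c.
  by case: c c3 {ce} => // x c; exists x; exact: mem_head.
case: (@arg_maxnP V x0 (mem c) d x0c) => x xc xmax.
case/rot_to: (xc) => i s crot.
have [sc su] : cycle e (x :: s) /\ uniq (x :: s).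
  by rewrite -crot rot_cycle rot_uniq; apply/andP.
have dm y : y \in s -> d y <= d x.
  by move=> ys; apply: xmax; rewrite inE -(mem_rot i) crot inE ys orbT.
have : 2 < size (x :: s) by rewrite -crot size_rot.
case: s sc su dm {crot} => [|y [|z s]] //= + /and3P[_ ys _] dm _.
rewrite rcons_path => /and4P[exy _ _ elx].
have dlow w : e x w -> w \in y :: z :: s -> d w < d x.
  by move=> /d1 + /dm; lia.
have lm : last z s \in z :: s := mem_last z s.
have yl : y = last z s.
  have exl : e x (last z s) by rewrite esym.
  by apply: (d2 x) => //; apply: dlow; rewrite // in_cons ?eqxx ?lm ?orbT.
by rewrite yl lm in ys.
Qed.

(* A descent after an ascent would revisit the unique lower neighbour of the peak. *)
Lemma depth_up d x0 (s : seq V) i j :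
  depth_function d -> is_path e s -> symmetric e ->
  i <= j -> j.+1 < size s ->
  d (nth x0 s i.+1) = (d (nth x0 s i)).+1 ->
  d (nth x0 s j.+1) = (d (nth x0 s j)).+1.
Proof.
move=> [d1 d2] /and3P[_ se su] esym ij js up.
elim: j ij js => [|j IH].
  by rewrite leqn0 => /eqP i0; rewrite i0 in up.
rewrite leq_eqVlt => /predU1P[<- //|ij] js.
have {}up := IH ij (ltnW js).
have e1 : e (nth x0 s j) (nth x0 s j.+1) by apply: (sortedP x0 se); lia.
have e2 : e (nth x0 s j.+1) (nth x0 s j.+2) by apply: (sortedP x0 se).
have [//|down] := d1 _ _ e2.
have /eqP : nth x0 s j = nth x0 s j.+2.
  by apply: (d2 (nth x0 s j.+1)); [rewrite esym | | rewrite up | rewrite down].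
by rewrite nth_uniq ?(ltnW (ltnW js)) //; lia.
Qed.

(** [k.*2.-1] is the least length whose half, rounded up, is [k]. Such a path has at least [2k]
    vertices, and the direction of the edge from position [k.-1] to [k] decides on which side of it
    the [k] monotone edges, itself included, are found. *)
Lemma tree_coloring k (P : seq (seq V)) :
  0 < k -> is_tree e -> path_family e k.*2.-1 P ->
  exists c : edge e -> 'I_k, polychromatic (path_hypergraph e P) c.
Proof.
move=> k0 T PP; have [d dd] := tree_depth T.
have [esym _ _ _ _] := T; have [d1 d2] := dd.
pose h (A : {set V}) := \max_(x in A) d x.
have h2 x y : h [set x; y] = maxn (d x) (d y).
  have [->|xy] := eqVneq x y; first by rewrite setUid /h big_set1 maxnn.
  by rewrite /h big_setU1 ?big_set1 // inE.
exists (fun f => Ordinal (ltn_pmod (h (val f)) k0)) => A /mapP[s sP ->] a.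
have [sp sc] := PP s sP; rewrite path_edges_card // in sc.
have [s0 se su] := and3P sp.
have [x0 _] : exists x, x \in s.
  by case: (s) s0 => // x t _; exists x; exact: mem_head.
pose D i := d (nth x0 s i).
have Dstep i : i.+1 < size s -> D i.+1 = (D i).+1 \/ D i = (D i.+1).+1.
  by move=> is_; apply: d1; apply: (sortedP x0 se).
(* Any [k] consecutive integers meet every residue class modulo [k]; the offset is [a - m] modulo
   [k], written without truncated subtraction. *)
have residue m : exists2 t, t < k & (m + t) %% k = a.
  exists ((a + (k - m %% k)) %% k); first exact: ltn_pmod.
  have mk : m %% k < k := ltn_pmod m k0.
  rewrite modnDmr -modnDml (_ : _ + _ = a + k); last by lia.
  by rewrite modnDr modn_small.
suff [m Hm] : exists m, forall t, t < k ->
    exists2 i, i.+1 < size s & maxn (D i) (D i.+1) = m + t.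
  have [t tk ta] := residue m; have [i is_ iE] := Hm t tk.
  have [f fs fE] := path_edges_nth x0 se is_.
  by exists f => //; apply: val_inj; rewrite /= fE h2 -ta -iE.
have n2 : k.*2 <= size s by move: sc; case: (size s) => [|n]; lia.
have ks : k < size s by lia.
have [up|down] : D k = (D k.-1).+1 \/ D k.-1 = (D k).+1.
- by have := Dstep k.-1; rewrite prednK //; apply.
- have Dup j : k.-1 <= j -> j.+1 < size s -> D j.+1 = (D j).+1.
    by move=> kj js; apply: (depth_up dd sp esym kj js); rewrite prednK.
  have Dlin t : t <= k -> D (k.-1 + t) = D k.-1 + t.
    elim: t => [|t IH] tk; first by rewrite !addn0.
    by rewrite addnS Dup ?IH; lia.
  (* The stretch starts at position [k.-1]; the successor appears because an edge is labelled by its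
     deeper end. *)
  exists (D k.-1).+1 => t tk; exists (k.-1 + t); first by lia.
  by rewrite -addnS !Dlin; lia.
(* An earlier ascent would persist through the middle edge, so the first [k] edges all descend; they
   are read backwards from position [k]. *)
have Ddown j : j < k -> D j = (D j.+1).+1.
  move=> jk; have [|up|//] := Dstep j; first by lia.
  have jk' : j <= k.-1 by lia.
  have ks' : k.-1.+1 < size s by rewrite prednK.
  have := depth_up dd sp esym jk' ks' up; rewrite prednK // -/(D k) -/(D k.-1).
  by rewrite down; lia.
have Dlin t : t <= k -> D (k - t) = D k + t.
  elim: t => [|t IH] tk; first by rewrite subn0 addn0.
  rewrite Ddown; last by lia.
  by rewrite (_ : (k - t.+1).+1 = k - t) ?IH; lia.
exists (D k).+1 => t tk; exists (k - t.+1); first by lia.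
by rewrite (_ : (k - t.+1).+1 = k - t) ?Dlin; lia.
Qed.

End Depth.

(** * The spider, where one more colour is impossible *)

Section Spider.

(* The centre is [None]; [Some (i, a)] is the vertex of leg [i] at distance
   [a + 1] from it. *)
Variables (I : finType) (k : nat).
Local Notation V := (option (I * 'I_k)).

Definition spider_parent (x y : V) : bool :=
  match x, y with
  | _, None => false
  | None, Some (_, b) => b == 0 :> nat
  | Some (i, a), Some (j, b) => (i == j) && (b == a.+1 :> nat)
  end.

Definition spider : rel V := fun x y => spider_parent x y || spider_parent y x.

Definition spider_depth (x : V) : nat := if x is Some (_, a) then a.+1 else 0.

Lemma spider_parent_depth x y :
  spider_parent x y -> spider_depth y = (spider_depth x).+1.
Proof. by case: x y => [[i a]|] [[j b]|] //= => [/andP[_ /eqP->]|/eqP->]. Qed.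

Lemma spider_parent_inj x y z :
  spider_parent x z -> spider_parent y z -> x = y.
Proof.
case: x y z => [[i a]|] [[j b]|] [[l c]|] //=.
- move=> /andP[/eqP-> /eqP->] /andP[/eqP-> /eqP[ab]].
  by congr (Some (_, _)); apply: val_inj.
- by move=> /andP[_ /eqP->].
- by move=> /eqP-> /andP[].
Qed.

Lemma spider_sym : symmetric spider.
Proof. by move=> x y; rewrite /spider orbC. Qed.

Lemma spider_depth_function : depth_function spider spider_depth.
Proof.
split=> [x y /orP[]/spider_parent_depth|x y z]; [by left | by right |].
case/orP=> [/spider_parent_depth->|yx]; first by lia.
case/orP=> [/spider_parent_depth->|zx _ _]; first by lia.
exact: spider_parent_inj yx zx.
Qed.

(** Every vertex is reached from the centre along its leg; acyclicity follows from the depth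
    function. *)
Lemma spider_tree : is_tree spider.
Proof.
split.
- exact: spider_sym.
- by move=> x; apply/negP => /orP[]/spider_parent_depth; lia.
- by apply/card_gt0P; exists None.
- have conn0 x : connect spider None x.
    case: x => [[i [a ak]]|]; last exact: connect0.
    elim: a ak => [|a IH] ak; first by apply: connect1; rewrite /spider /=.
    apply: connect_trans (IH (ltnW ak)) (connect1 _).
    by rewrite /spider /= !eqxx.
  move=> x y; apply: connect_trans (conn0 y).
  by rewrite (sym_connect_sym spider_sym).
- by move=> c cc; apply: depth_acyclic spider_depth_function cc spider_sym.
Qed.

Definition spider_leg (i : I) : seq V := [seq Some (i, a) | a <- enum 'I_k].

Definition spider_path (i j : I) : seq V :=
  rev (spider_leg i) ++ None :: spider_leg j.

Lemma mem_spider_leg i x :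
  x \in spider_leg i = (if x is Some (j, _) then j == i else false).
Proof.
apply/mapP/idP => [[a _ ->]|]; first exact: eqxx.
by case: x => [[j a] /eqP->|//]; exists a; rewrite ?mem_enum.
Qed.

Lemma size_spider_leg i : size (spider_leg i) = k.
Proof. by rewrite size_map size_enum_ord. Qed.

Lemma spider_leg_path i : path spider None (spider_leg i).
Proof.
have nth_leg a (ak : a < k) : nth None (spider_leg i) a = Some (i, Ordinal ak).
  rewrite (nth_map (Ordinal ak)) ?size_enum_ord //.
  by congr (Some (_, _)); apply: val_inj; rewrite /= nth_enum_ord.
apply/(pathP None) => -[|a]; rewrite size_spider_leg => ak; rewrite (nth_leg _ ak).
  by [].
by rewrite -cat1s nth_cat /= subn1 /= (nth_leg _ (ltnW ak)) /spider /= !eqxx.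
Qed.

Lemma spider_path_is_path i j : i != j -> is_path spider (spider_path i j).
Proof.
move=> ij; have legu l : uniq (spider_leg l).
  by rewrite map_inj_uniq ?enum_uniq // => a b [].
apply/and3P; split; first by rewrite /spider_path; case: (rev _).
- rewrite /spider_path sorted_cat_cons spider_leg_path andbT.
  rewrite -rev_cons rev_sorted (@eq_sorted _ _ spider) /= ?spider_leg_path //.
  by move=> x y; exact: spider_sym.
rewrite cat_uniq rev_uniq /= !legu mem_rev !mem_spider_leg /= !andbT.
apply/hasPn => x; rewrite mem_rev !mem_spider_leg.
by case: x => [[l a] /eqP->|//]; rewrite eq_sym.
Qed.

Lemma size_spider_path i j : size (spider_path i j) = k.*2.+1.
Proof. by rewrite size_cat size_rev /= !size_spider_leg; lia. Qed.

(** Indexing edges by their end away from the centre includes the innermost edge and makes the count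
    [k] visible. *)
Definition leg_edges (i : I) : {set edge spider} :=
  [set f | [exists u, [exists a,
    spider_parent u (Some (i, a)) && (val f == [set u; Some (i, a)])]]].

(** An edge belongs to the leg of its end away from the centre. Hence a colour absent from both legs
    is absent from the path. *)
Lemma spider_path_edges i j : i != j ->
  path_edges spider (spider_path i j) \subset leg_edges i :|: leg_edges j.
Proof.
move=> ij; have /and3P[_ se _] := spider_path_is_path ij.
have legE u v (f : edge spider) :
    spider_parent u v -> v \in spider_path i j -> val f = [set u; v] ->
    f \in leg_edges i :|: leg_edges j.
  case: v => [[l a]|] uv; last by case: u uv => [[]|].
  rewrite mem_cat mem_rev inE !mem_spider_leg /= => lij fE.
  have fl : f \in leg_edges l.
    by rewrite inE; apply/existsP; exists u; apply/existsP; exists a; rewrite uv; apply/eqP.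
  by rewrite in_setU; case/orP: lij => /eqP <-; rewrite fl ?orbT.
apply/subsetP => f; rewrite inE => /mapP[[u v] uv fE].
have [/= /orP[euv|evu] us vs] := sorted_zip_behead se uv.
  exact: legE euv vs fE.
by apply: legE evu us _; rewrite fE setUC.
Qed.

Lemma card_leg_edges i : #|leg_edges i| <= k.
Proof.
(* [F a] describes the edge from [Some (i, a)] towards the centre without choosing the parent;
   uniqueness of the parent identifies the two. *)
pose F a : {set V} := [set x | (x == Some (i, a)) || spider_parent x (Some (i, a))].
rewrite -(card_imset _ val_inj).
apply: leq_trans (_ : #|[set F a | a : 'I_k]| <= k); last first.
  by apply: leq_trans (leq_imset_card _ _) _; rewrite card_ord.
apply/subset_leq_card/subsetP => _ /imsetP[f + ->].
rewrite inE => /existsP[u /existsP[a /andP[ua /eqP->]]].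
apply/imsetP; exists a => //; apply/setP => x; rewrite !inE orbC.
congr (_ || _); apply/eqP/idP => [->//|xa]; exact: spider_parent_inj xa ua.
Qed.

Definition spider_paths : seq (seq V) :=
  [seq spider_path u.1 u.2 | u <- enum {: I * I} & u.1 != u.2].

Lemma spider_path_family r : r <= k.*2 -> path_family spider r spider_paths.
Proof.
move=> rk s /mapP[[i j]]; rewrite mem_filter /= => /andP[ij _] ->.
by rewrite path_edges_card spider_path_is_path // size_spider_path.
Qed.

Lemma spider_not_polychromatic (c : edge spider -> 'I_k.+1) :
  k.+1 < #|I| -> ~ polychromatic (path_hypergraph spider spider_paths) c.
Proof.
move=> kI Hc.
have gE i : exists a, a \notin c @: leg_edges i.
  apply/existsP; rewrite -negb_forall; apply/negP => /forallP all_.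
  have : #|'I_k.+1| <= k.
    apply: leq_trans (card_leg_edges i); apply: leq_trans (leq_imset_card c _).
    by apply/subset_leq_card/subsetP => a _; apply: all_.
  by rewrite card_ord ltnn.
pose g i := xchoose (gE i).
(* [g] picks a missing colour for each leg, and there are more legs than colours. *)
have /injectivePn[i [j ij gij]] : ~~ injectiveb g.
  by apply/negP => /injectiveP/leq_card; rewrite card_ord leqNgt kI.
have [|f fP cf] := Hc (path_edges spider (spider_path i j)) _ (g i).
  apply/map_f/mapP; exists (i, j) => //.
  by rewrite mem_filter ij mem_enum.
have /setUP[fi|fj] := subsetP (spider_path_edges ij) f fP.
  by have := xchooseP (gE i); rewrite -/(g i) -cf imset_f.
by have := xchooseP (gE j); rewrite -/(g j) -gij -cf imset_f.
Qed.

End Spider.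

Theorem theorem5 (r : nat) (hr : 1 <= r) :
  [/\
    (* (i) *)
    forall (V : finType) (e : rel V) (P : seq (seq V)),
      is_tree e -> path_family e r P ->
      exists c : edge e -> 'I_(uphalf r), polychromatic (path_hypergraph e P) c,
    (* (ii) *)
    exists (V : finType) (e : rel V) (P : seq (seq V)),
      [/\ is_tree e, path_family e r P
        & forall c : edge e -> 'I_(uphalf r).+1,
            ~ polychromatic (path_hypergraph e P) c]
    (* the minimum polychromatic number is uphalf r, the ceiling of r / 2 *)
  & (exists (V : finType) (e : rel V) (P : seq (seq V)),
      [/\ is_tree e, path_family e r P
        & is_polychromatic_number (path_hypergraph e P) (uphalf r)]) /\
    (forall (V : finType) (e : rel V) (P : seq (seq V)) (m : nat),
      is_tree e -> path_family e r P ->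
      is_polychromatic_number (path_hypergraph e P) m -> uphalf r <= m)].
Proof.
set k := uphalf r.
have colorable (V : finType) (e : rel V) (P : seq (seq V)) :
    is_tree e -> path_family e r P ->
    exists c : edge e -> 'I_k, polychromatic (path_hypergraph e P) c.
  move=> T PP; apply: tree_coloring => //; first by rewrite /k; lia.
  by move=> s /PP[? rs]; split=> //; apply: leq_trans rs; rewrite /k; lia.
(* One leg more than the [k.+1] colours to be excluded. *)
pose I := 'I_k.+2.
have family : path_family (@spider I k) r (@spider_paths I k).
  by apply: spider_path_family; rewrite /k; lia.
have no_coloring (c : edge (@spider I k) -> 'I_k.+1) :
    ~ polychromatic (path_hypergraph (@spider I k) (@spider_paths I k)) c.
  by apply: spider_not_polychromatic; rewrite card_ord.
have T := spider_tree I k.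
split; [exact: colorable | by exists _, (@spider I k), (@spider_paths I k) | split].
  exists _, (@spider I k), (@spider_paths I k); split=> //.
  split=> [|k' c Hc]; first exact: colorable.
  (* More than [k] colours could be merged into exactly [k.+1]. *)
  by rewrite leqNgt; apply/negP => kk'; apply: no_coloring (polychromatic_merge kk' Hc).
by move=> V e P m T' PP [_ max_m]; have [c Hc] := colorable _ _ _ T' PP; exact: max_m Hc.
Qed.
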